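(* For all $i\geq 1$, $\mathbf{V}(S_{\mathbb{B}_i})=\mathbf{V}(S_{\mathbb{B}_1})$, where $\mathbb{B}_i$ is the $i$-th beam-type 3-hypergraph.
   Context: A 3-uniform hypergraph $\mathbb{H}=(V,E)$ has a finite vertex set $V$ and a set $E$ of 3-element subsets of $V$ (hyperedges). All hypergraphs considered are linear (any two distinct hyperedges share at most one vertex) and every vertex lies in some hyperedge. A subhyperedge is a nonempty subset of a hyperedge. Two subhyperedges $e_1',e_2'$ are linked if there is a single vertex $w\notin e_1'\cup e_2'$ such that $e_1'\cup\{w\}$ and $e_2'\cup\{w\}$ are both hyperedges. The 3-hypergraph semigroup of $\mathbb{H}$ is the semigroup given by the presentation with generators $\mathbf{a}_u$ ($u\in V$) and $0$, and relations: $\mathbf{a}_u\mathbf{a}_v=\mathbf{a}_v\mathbf{a}_u$; $0\mathbf{a}_u=\mathbf{a}_u0=00=0$; $\mathbf{a}_u\mathbf{a}_v=0$ if $u=v$ or $\{u,v\}$ is not a subhyperedge; $\mathbf{a}_u\mathbf{a}_v\mathbf{a}_h=0$ if $\{u,v,h\}\notin E$; $\mathbf{a}_{u_i}\mathbf{a}_{u_j}=\mathbf{a}_{u_r}\mathbf{a}_{u_l}$ if $\{u_i,u_j\}$ and $\{u_r,u_l\}$ are linked; and for every hyperedge $\{u,v,w\}$, $\mathbf{a}_u\mathbf{a}_v\mathbf{a}_w=\mathbf{a}$, where $\mathbf{a}$ is one and the same (nonzero) element for all hyperedges. This semigroup with zero is 0-cancellative, and therefore becomes a semiring $S_{\mathbb{H}}$,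 called the 3-hypergraph semiring of $\mathbb{H}$, under the flat addition $x+x=x$ and $x+y=0$ for $x\ne y$. Beam-type 3-hypergraphs: for $i\ge1$, $\mathbb{B}_i$ is a strip of $i$ consecutive triangles. It has $3i+3$ pairwise distinct vertices: corners $w_1,\dots,w_{i+2}$, and midpoints $m_1,\dots,m_{i+1}$ and $m'_1,\dots,m'_i$; its $2i+1$ hyperedges are $\{w_j,m_j,w_{j+1}\}$ for $1\le j\le i+1$ and $\{w_j,m'_j,w_{j+2}\}$ for $1\le j\le i$. In particular $\mathbb{B}_1$ is the 3-cycle 3-hypergraph (triangle): 6 vertices $u_1,\dots,u_6$ and hyperedges $\{u_1,u_2,u_3\},\{u_3,u_4,u_5\},\{u_5,u_6,u_1\}$. $\mathbf{V}(S)$ denotes the variety generated by the semiring $S$, in the signature $\{+,\cdot\}$ (both operations associative, $+$ commutative, $\cdot$ distributing over $+$ on both sides). *)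

(* Defs.v *)
From mathcomp Require Import all_boot.
From mathcomp Require Import boolp zify.

Set Implicit Arguments.
Unset Strict Implicit.
Unset Printing Implicit Defensive.

(* Semirings in the signature {+, *}: no constants 0 and 1 are required, in
   contrast with the ring-like structures of [ssralg]. *)
Record semiring : Type := Semiring {
  carrier :> Type;
  sadd : carrier -> carrier -> carrier;
  smul : carrier -> carrier -> carrier;
  saddA : associative sadd;
  saddC : commutative sadd;
  smulA : associative smul;
  smulDl : left_distributive smul sadd;
  smulDr : right_distributive smul sadd
}.

Definition semiring_morphism (S T : semiring) (f : S -> T) : Prop :=
  {morph f : x y / sadd x y} /\ {morph f : x y / smul x y}.

Section Product.
Variables (I : Type) (F : I -> semiring).
Implicit Types x y z : forall i, F i.

Let padd x y : forall i, F i := fun i => sadd (x i) (y i).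
Let pmul x y : forall i, F i := fun i => smul (x i) (y i).

Fact paddA : associative padd.
Proof. by move=> x y z; apply: functional_extensionality_dep => i; apply: saddA. Qed.
Fact paddC : commutative padd.
Proof. by move=> x y; apply: functional_extensionality_dep => i; apply: saddC. Qed.
Fact pmulA : associative pmul.
Proof. by move=> x y z; apply: functional_extensionality_dep => i; apply: smulA. Qed.
Fact pmulDl : left_distributive pmul padd.
Proof. by move=> x y z; apply: functional_extensionality_dep => i; apply: smulDl. Qed.
Fact pmulDr : right_distributive pmul padd.
Proof. by move=> x y z; apply: functional_extensionality_dep => i; apply: smulDr. Qed.

Definition prod_semiring : semiring := Semiring paddA paddC pmulA pmulDl pmulDr.
End Product.

(* A variety is a class of semirings closed under homomorphic images,
   subalgebras (given up to isomorphism, as embeddings) and arbitrary direct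
   products. Empty carriers are not excluded. *)
Record is_variety (K : semiring -> Prop) : Prop := IsVariety {
  variety_hom : forall (S T : semiring) (f : S -> T),
    semiring_morphism f -> (forall y, exists x, f x = y) -> K S -> K T;
  variety_sub : forall (S T : semiring) (f : T -> S),
    semiring_morphism f -> injective f -> K S -> K T;
  variety_prod : forall (I : Type) (F : I -> semiring),
    (forall i, K (F i)) -> K (prod_semiring F)
}.

(* The smallest variety containing [S]. *)
Definition variety_gen (S T : semiring) : Prop :=
  forall K : semiring -> Prop, is_variety K -> K S -> K T.

Section Presentation.
Variables (G : choiceType) (R : seq G -> seq G -> Prop).
Implicit Types s t p q : seq G.

(* The congruence generated by [R]. The contexts [p] and [q] may be empty. *)
Inductive pres_eq : seq G -> seq G -> Prop :=
| pres_rel p q s t : R s t -> pres_eq (p ++ s ++ q) (p ++ t ++ q)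
| pres_refl s : pres_eq s s
| pres_sym s t : pres_eq s t -> pres_eq t s
| pres_trans s t q : pres_eq s t -> pres_eq t q -> pres_eq s q.

Lemma pres_eq_ctx p q s t : pres_eq s t -> pres_eq (p ++ s ++ q) (p ++ t ++ q).
Proof.
elim=> {s t} [p' q' s t Rst|s|s t _ IH|s t r _ IH1 _ IH2].
- by have := pres_rel (p ++ p') (q' ++ q) Rst; rewrite -!catA.
- exact: pres_refl.
- exact: pres_sym.
- exact: pres_trans IH1 IH2.
Qed.

Lemma pres_eq_cat s s' t t' :
  pres_eq s s' -> pres_eq t t' -> pres_eq (s ++ t) (s' ++ t').
Proof.
move=> ss' tt'; apply: (@pres_trans _ (s' ++ t)).
  exact: (@pres_eq_ctx [::] t _ _ ss').
by have := pres_eq_ctx s' [::] tt'; rewrite !cats0.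
Qed.

(* Nonempty words, i.e., the free semigroup on [G]. *)
Definition word := {s : seq G | s != [::]}.

Fact wcat_subproof (x y : word) : val x ++ val y != [::].
Proof. by case: x => -[]. Qed.
Definition wcat (x y : word) : word := Sub (val x ++ val y) (wcat_subproof x y).

Definition wletter (g : G) : word := Sub [:: g] isT.

Definition word_eq : rel word := fun x y => `[< pres_eq (val x) (val y) >].

Fact word_eq_refl : reflexive word_eq.
Proof. by move=> x; apply/asboolP/pres_refl. Qed.
Fact word_eq_sym : symmetric word_eq.
Proof. by move=> x y; apply/asboolP/asboolP; apply: pres_sym. Qed.
Fact word_eq_trans : transitive word_eq.
Proof.
by move=> y x z /asboolP xy /asboolP yz; apply/asboolP/(pres_trans xy yz).
Qed.
Canonical word_equiv := EquivRel word_eq word_eq_refl word_eq_sym word_eq_trans.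

Local Open Scope quotient_scope.

Definition pres_semigroup := {eq_quot word_equiv}.

Definition pres_gen (g : G) : pres_semigroup := \pi_pres_semigroup (wletter g).

Definition pres_mul (x y : pres_semigroup) : pres_semigroup :=
  \pi_pres_semigroup (wcat (repr x) (repr y)).

Lemma pres_piP (x y : word) :
  x = y %[mod pres_semigroup] <-> pres_eq (val x) (val y).
Proof.
by split=> [/eqmodP/asboolP|H] //; apply/eqmodP/asboolP.
Qed.

Lemma pres_mulE (x y : word) :
  pres_mul (\pi x) (\pi y) = \pi_pres_semigroup (wcat x y).
Proof.
by apply/pres_piP/pres_eq_cat; apply/pres_piP; rewrite reprK.
Qed.

Lemma pres_mulA : associative pres_mul.
Proof.
move=> x y z; rewrite -[x]reprK -[y]reprK -[z]reprK !pres_mulE.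
by congr (\pi_pres_semigroup _); apply: val_inj; rewrite /= catA.
Qed.

End Presentation.

Definition zero_cancellative (S : Type) (mul : S -> S -> S) (z : S) : Prop :=
  (forall a b c, mul a b = mul a c -> mul a b <> z -> b = c) /\
  (forall a b c, mul b a = mul c a -> mul b a <> z -> b = c).

Definition flat_add (S : eqType) (z x y : S) : S := if x == y then x else z.

Section Flat.
Variables (S : eqType) (mul : S -> S -> S) (z : S).
Hypotheses (mulA : associative mul) (mul0 : left_zero z mul)
  (mulr0 : right_zero z mul) (mulI : zero_cancellative mul z).

Fact flat_addA : associative (flat_add z).
Proof.
move=> a b c; rewrite /flat_add.
case: (b =P c) => bc; case: (a =P b) => ab.
all: case: (a =P c) => ac; case: (z =P c) => zc; case: (a =P z) => az.
all: congruence.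
Qed.

Fact flat_addC : commutative (flat_add z).
Proof. by move=> a b; rewrite /flat_add eq_sym; case: eqP => [->|]. Qed.

Fact flat_mulDl : left_distributive mul (flat_add z).
Proof.
move=> a b c; rewrite /flat_add; have [->|nab] := eqVneq a b; first by rewrite eqxx.
rewrite mul0; case: eqP => // eab; apply/esym/eqP/contraT => /eqP nz.
by move: nab; rewrite (mulI.2 _ _ _ eab nz) eqxx.
Qed.

Fact flat_mulDr : right_distributive mul (flat_add z).
Proof.
move=> c a b; rewrite /flat_add; have [->|nab] := eqVneq a b; first by rewrite eqxx.
rewrite mulr0; case: eqP => // eab; apply/esym/eqP/contraT => /eqP nz.
by move: nab; rewrite (mulI.1 _ _ _ eab nz) eqxx.
Qed.

Definition flat_semiring : semiring :=
  Semiring flat_addA flat_addC mulA flat_mulDl flat_mulDr.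
End Flat.

Record hypergraph3 : Type := Hypergraph3 {
  vertex :> finType;
  hyperedges : {set {set vertex}};
  hyperedge_card : forall e, e \in hyperedges -> #|e| = 3;
  hyperedge_linear : forall e f, e \in hyperedges -> f \in hyperedges ->
    e != f -> #|e :&: f| <= 1;
  hyperedge_cover : forall v, exists2 e, e \in hyperedges & v \in e
}.

Section HypergraphSemiring.
Variable H : hypergraph3.
Notation E := (hyperedges H).
Implicit Types u v w h : H.

Definition subhyperedge (e' : {set H}) : bool :=
  (e' != set0) && [exists e in E, e' \subset e].

Definition linked (e1 e2 : {set H}) : bool :=
  [&& subhyperedge e1, subhyperedge e2 &
    [exists w, [&& w \notin e1 :|: e2, w |: e1 \in E & w |: e2 \in E]]].

(* [None] is the generator 0 and [Some u] is the generator a_u. *)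
Definition hg_generator := option H.

Local Notation "'0'" := (@None H).
Local Notation a := (@Some H).

Inductive hg_rel : seq hg_generator -> seq hg_generator -> Prop :=
| hg_comm u v : hg_rel [:: a u; a v] [:: a v; a u]
| hg_0l u : hg_rel [:: 0; a u] [:: 0]
| hg_0r u : hg_rel [:: a u; 0] [:: 0]
| hg_00 : hg_rel [:: 0; 0] [:: 0]
| hg_pair0 u v : (u = v) \/ ~~ subhyperedge [set u; v] ->
    hg_rel [:: a u; a v] [:: 0]
| hg_triple0 u v h : [set u; v; h] \notin E -> hg_rel [:: a u; a v; a h] [:: 0]
| hg_linked u v r l : linked [set u; v] [set r; l] ->
    hg_rel [:: a u; a v] [:: a r; a l]
| hg_edge u v w u' v' w' : [set u; v; w] \in E -> [set u'; v'; w'] \in E ->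
    hg_rel [:: a u; a v; a w] [:: a u'; a v'; a w'].

Definition hg_semigroup := pres_semigroup hg_rel.
Definition hg_mul : hg_semigroup -> hg_semigroup -> hg_semigroup :=
  @pres_mul _ hg_rel.
Definition hg_zero : hg_semigroup := pres_gen hg_rel 0.

(* A concrete model of the presented semigroup. In a linear hypergraph a pair
   of vertices {u, v} lies in at most one hyperedge {u, v, w}, and the pairs
   completed by [w] are exactly those linked to {u, v}: their common product
   is [MP w]. *)
Inductive hg_model := M0 | MV of H | MP of H | MT.

Definition model_mul (x y : hg_model) : hg_model :=
  match x, y with
  | MV u, MV v => if [pick w | [set u; v; w] \in E] is Some w then MP w else M0
  | MV u, MP w | MP w, MV u => if u == w then MT else M0
  | _, _ => M0
  end.

Definition model_gen (g : hg_generator) : hg_model :=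
  if g is Some u then MV u else M0.

Fixpoint model_eval (s : seq hg_generator) : hg_model :=
  match s with
  | [::] => M0
  | [:: g] => model_gen g
  | g :: s' => model_mul (model_gen g) (model_eval s')
  end.

Lemma edge_neq u v w : [set u; v; w] \in E -> [/\ u != v, u != w & v != w].
Proof.
move=> /hyperedge_card; rewrite setUC cardsU1 !inE cards2 negb_or.
by rewrite (eq_sym w u) (eq_sym w v); do !case: eqP.
Qed.

Lemma set3_rot u v w : [set u; v; w] = [set v; w; u].
Proof. by rewrite setUC setUA setUC setUA setUAC setUC setUA. Qed.

Lemma set3_swap u v w : [set u; v; w] = [set v; u; w].
Proof. by rewrite [[set u; v]]setUC. Qed.

Lemma edge_uniq u v w w' :
  [set u; v; w] \in E -> [set u; v; w'] \in E -> w = w'.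
Proof.
move=> e1 e2; have [n1 n2 n3] := edge_neq e1.
have [_ n2' n3'] := edge_neq e2.
have [eq12|] := eqVneq [set u; v; w] [set u; v; w'].
  have: w \in [set u; v; w'] by rewrite -eq12 !inE eqxx orbT.
  by rewrite !inE eq_sym (negPf n2) eq_sym (negPf n3) => /eqP.
move=> /(hyperedge_linear e1 e2).
have: [set u; v] \subset [set u; v; w] :&: [set u; v; w'].
  by apply/subsetP => x; rewrite !inE => ->.
by move=> /subset_leq_card; rewrite cards2 n1 => /leq_trans H2 /H2.
Qed.

Variant model_VV_spec u v : hg_model -> Prop :=
| ModelVVEdge w of [set u; v; w] \in E : model_VV_spec u v (MP w)
| ModelVVNone of (forall w, [set u; v; w] \notin E) : model_VV_spec u v M0.

Lemma model_VVP u v : model_VV_spec u v (model_mul (MV u) (MV v)).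
Proof.
by rewrite /=; case: pickP => [w e|n]; constructor=> // w; rewrite n.
Qed.

Lemma model_VV u v w : [set u; v; w] \in E -> model_mul (MV u) (MV v) = MP w.
Proof.
by move=> e; case: model_VVP => [w' /(edge_uniq e)->|/(_ w)/negP[]].
Qed.

Lemma model_VVV u v w : model_mul (model_mul (MV u) (MV v)) (MV w) =
  if [set u; v; w] \in E then MT else M0.
Proof.
case: (model_VVP u v) => [x e|n] /=; last by rewrite (negPf (n w)).
by have [->|nwx] := eqVneq w x; rewrite ?e //; case: ifP nwx => // /(edge_uniq e)->; rewrite eqxx.
Qed.

Lemma model_mulC : commutative model_mul.
Proof.
case=> [|u|u|] [|v|v|] //.
case: (model_VVP u v) => [w|n].
  by rewrite set3_swap => /model_VV->.
by case: model_VVP => // w; rewrite set3_swap (negPf (n w)).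
Qed.

Lemma model_mulA : associative model_mul.
Proof.
have VVl u v z : (forall w, z <> MV w) ->
    model_mul (model_mul (MV u) (MV v)) z = M0.
  by case: model_VVP => [x _|_]; case: z => // w /(_ w).
have VVr u v z : (forall w, z <> MV w) ->
    model_mul z (model_mul (MV u) (MV v)) = M0.
  by rewrite model_mulC; apply: VVl.
case=> [|u|u|] [|v|v|] [|w|w|] //.
all: try by rewrite ?VVl ?VVr //=; do ?case: ifP.
by rewrite model_mulC !model_VVV -set3_rot.
Qed.

Lemma edge_uniq2 u v w x :
  [set u; v; x] \in E -> [set u; w; x] \in E -> v = w.
Proof.
by rewrite -(set3_rot x u v) -(set3_rot x u w); apply: edge_uniq.
Qed.

Lemma model_mul_cancel x y z :
  model_mul x y = model_mul x z -> model_mul x y <> M0 -> y = z.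
Proof.
case: x => [|u|u|] //; case: y => [|v|v|] //.
- case: model_VVP => // x e; case: z => [|w|w|] //; last by rewrite /=; case: eqP.
  by case: model_VVP => // y e' [exy] _; subst y; rewrite (edge_uniq2 e e').
- rewrite [model_mul (MV u) (MP v)]/=; case: eqP => // <-.
  case: z => [|w|w|] //; first by case: model_VVP.
  by rewrite /=; case: eqP => // <-.
- rewrite /=; case: eqP => // ->; case: z => [|w|w|] //.
  by rewrite /=; case: eqP => // <-.
Qed.

Lemma model_evalE g s : s != [::] ->
  model_eval (g :: s) = model_mul (model_gen g) (model_eval s).
Proof. by case: s. Qed.

Lemma model_eval_cat s t : s != [::] -> t != [::] ->
  model_eval (s ++ t) = model_mul (model_eval s) (model_eval t).
Proof.
move=> + t0; elim: s => // g [|g' s] IH _; first by rewrite cat1s (model_evalE _ t0).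
rewrite cat_cons model_evalE; last by case: (t).
by rewrite IH // model_mulA -model_evalE.
Qed.

Lemma edge_linked u v r l w :
  [set u; v; w] \in E -> [set r; l; w] \in E -> linked [set u; v] [set r; l].
Proof.
move=> e1 e2; have [_ uw vw] := edge_neq e1; have [_ rw lw] := edge_neq e2.
have sub x y : [set x; y; w] \in E -> subhyperedge [set x; y].
  move=> e; apply/andP; split; first by apply/set0Pn; exists x; rewrite !inE eqxx.
  by apply/existsP; exists [set x; y; w]; rewrite e subsetUl.
apply/and3P; split; [exact: sub e1|exact: sub e2|apply/existsP; exists w].
by rewrite !inE ![w == _]eq_sym !negb_or uw vw rw lw ![w |: _]setUC e1 e2.
Qed.

Lemma hg_rel_eval s t : hg_rel s t ->
  [/\ s != [::], t != [::] & model_eval s = model_eval t].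
Proof.
case=> {s t} [u v|u|u||u v H0|u v h H0|u v r l luv|u v w u' v' w' e e'];
  split=> //.
- exact: model_mulC.
- rewrite -[LHS]/(model_mul (MV u) (MV v)).
  case: model_VVP => // w e; have [nuv _ _] := edge_neq e.
  case: H0 => [uv|/negP[]]; first by rewrite uv eqxx in nuv.
  by case/and3P: (edge_linked e e).
- by rewrite -[LHS]/(model_mul (MV u) (model_mul (MV v) (MV h))) model_mulA
    model_VVV (negPf H0).
- case/and3P: luv => _ _ /existsP[w /and3P[_ e e']]; rewrite setUC in e.
  rewrite setUC in e'.
  by rewrite -[LHS]/(model_mul (MV u) (MV v))
    -[RHS]/(model_mul (MV r) (MV l)) (model_VV e) (model_VV e').
- rewrite -[LHS]/(model_mul (MV u) (model_mul (MV v) (MV w))) model_mulA.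
  rewrite -[RHS]/(model_mul (MV u') (model_mul (MV v') (MV w'))) model_mulA.
  by rewrite !model_VVV e e'.
Qed.

Lemma pres_eval s t : pres_eq (@hg_rel) s t -> model_eval s = model_eval t.
Proof.
elim=> {s t} [p q s t /hg_rel_eval[s0 t0 st]|//|s t _ -> //|s t q _ -> _ -> //].
have stq : model_eval (s ++ q) = model_eval (t ++ q).
  case: q => [|g q]; first by rewrite !cats0.
  by rewrite !model_eval_cat // st.
case: p => [//|g p].
have neq0 (x : seq hg_generator) : x != [::] -> x ++ q != [::] by case: x.
by rewrite !(@model_eval_cat (g :: p)) ?stq ?neq0.
Qed.

Variant nf_spec : seq hg_generator -> hg_model -> Prop :=
| Nf0 : nf_spec [:: 0] M0
| NfV u : nf_spec [:: a u] (MV u)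
| NfP u v w of [set u; v; w] \in E : nf_spec [:: a u; a v] (MP w)
| NfT u v w of [set u; v; w] \in E : nf_spec [:: a u; a v; a w] MT.

Local Notation "s ~ t" := (pres_eq hg_rel s t) (at level 70).

Lemma hg_rel_eq s t : hg_rel s t -> s ~ t.
Proof. by move/(pres_rel [::] [::]); rewrite !cats0. Qed.

Lemma zero_cons g : [:: g; 0] ~ [:: 0].
Proof. by case: g => [u|]; apply: hg_rel_eq; constructor. Qed.

Lemma square_zero u : [:: a u; a u] ~ [:: 0].
Proof. by apply/hg_rel_eq/hg_pair0; left. Qed.

Lemma zero_ctx p q : p ++ [:: 0] ++ q ~ [:: 0].
Proof.
apply: (@pres_trans _ _ _ (p ++ [:: 0])); last first.
  elim: p => [|g p IH]; first exact: pres_refl.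
  apply: pres_trans (zero_cons g).
  exact: (@pres_eq_cat _ _ [:: g] [:: g] _ _ (pres_refl _ _) IH).
apply: (@pres_eq_cat _ _ p p _ _ (pres_refl _ _)).
elim: q => [|g q IH]; first exact: pres_refl.
apply: pres_trans IH.
apply: (@pres_eq_cat _ _ [:: 0; g] [:: 0] q q); last exact: pres_refl.
by case: g => [u|]; apply: hg_rel_eq; constructor.
Qed.

Lemma nf_exists s : s != [::] -> exists2 t, s ~ t & nf_spec t (model_eval s).
Proof.
elim: s => // g s IH _; have [->|/[dup] s0 /IH[t st nt]] := eqVneq s [::].
  by case: g => [u|] /=; [exists [:: a u] | exists [:: 0]];
    try exact: pres_refl; constructor.
have gst : g :: s ~ g :: t.
  by apply: (@pres_eq_cat _ _ [:: g] [:: g]) => //; apply: pres_refl.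
suff [t' gt nt'] : exists2 t', g :: t ~ t' & nf_spec t' (model_eval (g :: s)).
  by exists t' => //; apply: pres_trans gst gt.
have out x : g :: t ~ [:: 0] -> x = M0 -> exists2 t', g :: t ~ t' & nf_spec t' x.
  by move=> ? ->; exists [:: 0] => //; constructor.
rewrite model_evalE //.
case: g => [u|] in gst out *; last first.
  by apply: out => //; apply: (zero_ctx [::] t).
rewrite /model_gen.
case: nt out => {t st gst} [|v|v h w e|v h w e] out.
- by apply: out => //; apply: zero_cons.
- case: (model_VVP u v) out => [w e|n] out.
    by exists [:: a u; a v]; [apply: pres_refl|constructor].
  apply: out => //; apply: hg_rel_eq; apply: hg_pair0.
  have [->|nuv] := eqVneq u v; [by left|right; apply/negP].
  case/andP=> _ /existsP[f /andP[fE sub]].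
  have f3 := hyperedge_card fE.
  have : #|f :\: [set u; v]| = 1 by rewrite cardsD (setIidPr sub) f3 cards2 nuv.
  move/eqP/cards1P=> [w fw]; move: (n w).
  by rewrite -fw -{1}(setIidPr sub) setID fE.
- rewrite -(model_VV e) model_mulA model_VVV in out *.
  case: ifP => [e'|/negbT ne].
    by exists [:: a u; a v; a h]; [apply: pres_refl|constructor].
  by apply: out => //; apply/hg_rel_eq/hg_triple0.
- apply: out => //.
  have [e'|ne] := boolP ([set u; v; h] \in E); last first.
    apply: pres_trans (zero_ctx [::] [:: a w]).
    exact: (@pres_rel _ _ [::] [:: a w] _ _ (hg_triple0 ne)).
  have uw : u = w.
    by rewrite set3_rot in e'; apply: edge_uniq e' e.
  rewrite {}uw.
  apply: (@pres_trans _ _ _ [:: a w; a v; a w; a h]).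
    exact: (@pres_rel _ _ [:: a w; a v] [::] _ _ (hg_comm h w)).
  apply: (@pres_trans _ _ _ [:: a w; a w; a v; a h]).
    exact: (@pres_rel _ _ [:: a w] [:: a h] _ _ (hg_comm v w)).
  apply: pres_trans (zero_ctx [::] [:: a v; a h]).
  exact: (@pres_eq_ctx _ _ [::] [:: a v; a h] _ _ (square_zero w)).
Qed.

Lemma nf_uniq s t x : nf_spec s x -> nf_spec t x -> s ~ t.
Proof.
case=> [|u|u v w e|u v w e] nt; inversion nt; subst; try exact: pres_refl.
  by apply/hg_rel_eq/hg_linked; apply: (edge_linked e).
by apply/hg_rel_eq; apply: hg_edge.
Qed.

Lemma model_evalP s t : s != [::] -> t != [::] ->
  (s ~ t) <-> (model_eval s = model_eval t).
Proof.
move=> s0 t0; split; first exact: pres_eval.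
have [s' ss' ns] := nf_exists s0; have [t' tt' nt] := nf_exists t0.
move=> st; rewrite st in ns; apply: pres_trans ss' _.
by apply: pres_trans (pres_sym tt'); apply: nf_uniq ns nt.
Qed.

Definition hg_eval (x : hg_semigroup) : hg_model := model_eval (val (repr x)).

Local Open Scope quotient_scope.

Lemma word_neq0 (G : choiceType) (x : word G) : val x != [::].
Proof. by case: x. Qed.

Lemma hg_eval_pi (x : word hg_generator) :
  hg_eval (\pi_hg_semigroup x) = model_eval (val x).
Proof.
apply/model_evalP; [exact: word_neq0|exact: word_neq0|apply/pres_piP].
by rewrite reprK.
Qed.

Lemma hg_eval_inj : injective hg_eval.
Proof.
move=> x y; rewrite -[x]reprK -[y]reprK !hg_eval_pi => xy.
by apply/pres_piP/model_evalP => //; apply: word_neq0.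
Qed.

Lemma hg_evalM x y : hg_eval (hg_mul x y) = model_mul (hg_eval x) (hg_eval y).
Proof. by rewrite hg_eval_pi model_eval_cat //; apply: word_neq0. Qed.

Lemma hg_eval0 : hg_eval hg_zero = M0.
Proof. exact: hg_eval_pi. Qed.

Fact hg_mulA : associative hg_mul.
Proof. exact: pres_mulA. Qed.

Lemma hg_mulC : commutative hg_mul.
Proof. by move=> x y; apply: hg_eval_inj; rewrite !hg_evalM model_mulC. Qed.

Fact hg_mul0l : left_zero hg_zero hg_mul.
Proof. by move=> x; apply: hg_eval_inj; rewrite hg_evalM hg_eval0. Qed.

Fact hg_mul0r : right_zero hg_zero hg_mul.
Proof. by move=> x; rewrite hg_mulC hg_mul0l. Qed.

Fact hg_zero_cancellative : zero_cancellative hg_mul hg_zero.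
Proof.
have cancel x y z : hg_mul x y = hg_mul x z -> hg_mul x y <> hg_zero -> y = z.
  move=> xyz xy0; apply: hg_eval_inj; apply: (@model_mul_cancel (hg_eval x)).
    by rewrite -!hg_evalM xyz.
  by rewrite -hg_evalM -hg_eval0 => /hg_eval_inj.
by split=> // x y z; rewrite !(hg_mulC _ x); apply: cancel.
Qed.

Definition hg_semiring : semiring :=
  flat_semiring hg_mulA hg_mul0l hg_mul0r hg_zero_cancellative.

End HypergraphSemiring.

Section Beam.
Variable i : nat.

(* The three summands index the corners w, the midpoints m and the midpoints
   m'; all indices start from 0. *)
Definition beam_vertex : finType := ('I_i.+2 + 'I_i.+1 + 'I_i)%type.

(* Only used with [k < i.+2]. *)
Definition corner (k : nat) : beam_vertex := inl (inl (inord k)).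
Definition midpoint (j : 'I_i.+1) : beam_vertex := inl (inr j).
Definition midpoint' (j : 'I_i) : beam_vertex := inr j.

Definition beam_edge (j : 'I_i.+1) : {set beam_vertex} :=
  [set corner j; midpoint j; corner j.+1].
Definition beam_edge' (j : 'I_i) : {set beam_vertex} :=
  [set corner j; midpoint' j; corner j.+2].

Definition beam_edges : {set {set beam_vertex}} :=
  [set beam_edge j | j : 'I_i.+1] :|: [set beam_edge' j | j : 'I_i].

Lemma corner_inj j k : j < i.+2 -> k < i.+2 -> (corner j == corner k) = (j == k).
Proof.
move=> ji ki; apply/eqP/eqP => [[/(congr1 val)]|->] //.
by rewrite /= !inordK.
Qed.

Variant beam_edge_spec : {set beam_vertex} -> Prop :=
| BeamEdge (p q : nat) m of p < q & q < i.+2 & (forall k, m != corner k)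
    & (if m is inl (inr j) then p = j /\ q = j.+1
       else if m is inr j then p = j /\ q = j.+2 else False) :
    beam_edge_spec [set corner p; m; corner q].

Lemma beam_edgesP e : e \in beam_edges -> beam_edge_spec e.
Proof.
case/setUP=> /imsetP[j _ ->].
  by apply: (@BeamEdge j j.+1 (midpoint j)); rewrite // ltnS.
by apply: (@BeamEdge j j.+2 (midpoint' j)); rewrite // ?ltnS ?leqnSn.
Qed.

Fact beam_card e : e \in beam_edges -> #|e| = 3.
Proof.
case/beam_edgesP=> p q m pq qi mc _.
have cm k : (corner k == m) = false by rewrite eq_sym (negPf (mc k)).
rewrite setUC cardsU1 !inE cards2 !cm corner_inj ?(ltn_trans pq) //.
by rewrite (gtn_eqF pq).
Qed.

Fact beam_linear e f : e \in beam_edges -> f \in beam_edges -> e != f ->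
  #|e :&: f| <= 1.
Proof.
case/beam_edgesP=> p q m pq qi mc spec; case/beam_edgesP=> p' q' m' pq' qi' mc' spec'.
have pi := ltn_trans pq qi; have pi' := ltn_trans pq' qi'.
apply: contraNT; rewrite -ltnNge => /card_gt1P[x [y []]].
have cm k : (corner k == m) = false by rewrite eq_sym (negPf (mc k)).
have cm' k : (corner k == m') = false by rewrite eq_sym (negPf (mc' k)).
have [mm|nmm] := eqVneq m m'.
  move=> _ _ _; subst m'; case: m spec spec' {mc mc' cm cm'} => [[//|j]|j].
    by case=> -> -> [-> ->].
  by case=> -> -> [-> ->].
have corners z :
    z \in [set corner p; m; corner q] :&: [set corner p'; m'; corner q'] ->
    exists k, [/\ z = corner k, k = p \/ k = q & k = p' \/ k = q'].
  rewrite !inE; have [->|_] := eqVneq z m.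
    by rewrite (negPf nmm) !(negPf (mc _)) andbF.
  have [->|_] := eqVneq z m'; first by rewrite !(negPf (mc' _)).
  rewrite !orbF => /andP[/orP[]/eqP->]; rewrite !corner_inj // => /orP[]/eqP ?.
  - by exists p; split; [|left|left].
  - by exists p; split; [|left|right].
  - by exists q; split; [|right|left].
  - by exists q; split; [|right|right].
move=> /corners[k [-> kpq kpq']] /corners[l [-> lpq lpq']] nkl.
have {}nkl : k <> l by move=> kl; rewrite kl eqxx in nkl.
have [pp qq] : p = p' /\ q = q' by clear -pq pq' kpq kpq' lpq lpq' nkl; lia.
subst p' q'; case/eqP: nmm; move: spec spec'.
case: m {mc cm corners} => [[//|j]|j]; case: m' {mc' cm'} => [[//|j']|j'] [jp jq] [jp' jq'].
- by congr (inl (inr _)); apply: val_inj; rewrite /= -jp -jp'.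
- by clear -jp jq jp' jq'; lia.
- by clear -jp jq jp' jq'; lia.
- by congr inr; apply: val_inj; rewrite /= -jp -jp'.
Qed.

Fact beam_cover v : exists2 e, e \in beam_edges & v \in e.
Proof.
have edge j : beam_edge j \in beam_edges by rewrite inE imset_f.
have edge' j : beam_edge' j \in beam_edges by rewrite inE imset_f ?orbT.
case: v => [[k|j]|j]; last 2 first.
- by exists (beam_edge j); rewrite // !inE eqxx ?orbT.
- by exists (beam_edge' j); rewrite // !inE eqxx ?orbT.
have [ki|ki] := ltnP k i.+1.
  exists (beam_edge (Ordinal ki)); rewrite // !inE.
  by apply/orP; left; apply/orP; left; apply/eqP; congr (inl (inl _)); rewrite /= inord_val.
have -> : k = inord i.+1.
  by apply: val_inj; rewrite /= inordK //; apply/eqP; rewrite eqn_leq ki -ltnS ltn_ord.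
by exists (beam_edge ord_max); rewrite // !inE eqxx !orbT.
Qed.

Definition beam : hypergraph3 := Hypergraph3 beam_card beam_linear beam_cover.
End Beam.

(* Main.v *)
(* A flat semiring S lies in the variety of a flat semiring S' as soon as there
   are maps S -> S', multiplicative on nonzero products, that jointly separate
   nonzero elements and detect zero products: the images of nonzero elements in
   the power of S', together with all tuples having a zero coordinate, form a
   subsemiring, and collapsing the latter tuples to 0 gives S. For hypergraph
   semirings such maps come from hypergraph homomorphisms that separate vertices
   and send each nonadjacent pair to a nonadjacent or equal pair at least once.
   For B_1 -> B_i the inclusion suffices. For B_i -> B_1, colour the corner w_k
   by k mod 3 and each midpoint by the colour missing from its edge. A vertex of
   B_1 is determined by its colour and by whether it is a midpoint, and an edge
   of B_1 consists of three colours with exactly one midpoint. So every set of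
   vertices of B_i meeting each edge exactly once (a transversal) defines a
   homomorphism, sending the set to midpoints; as any two midpoints of B_1 are
   nonadjacent or equal, it remains to put each nonadjacent pair of B_i in a
   transversal. *)
Require Import Defs.
From mathcomp Require Import all_boot.
From mathcomp Require Import boolp zify.

Set Implicit Arguments.
Unset Strict Implicit.
Unset Printing Implicit Defensive.

(** * Varieties and subsemirings *)

Lemma variety_gen_trans (S S' T : semiring) :
  variety_gen S' S -> variety_gen S T -> variety_gen S' T.
Proof. by move=> SS' ST K vK KS'; apply: ST => //; apply: SS'. Qed.

Section Subsemiring.
Variables (S : semiring) (B : S -> Prop).
Hypotheses (BD : forall x y, B x -> B y -> B (sadd x y))
  (BM : forall x y, B x -> B y -> B (smul x y)).

Let add (x y : {x | B x}) : {x | B x} :=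
  exist B (sadd (sval x) (sval y)) (BD (svalP x) (svalP y)).
Let mul (x y : {x | B x}) : {x | B x} :=
  exist B (smul (sval x) (sval y)) (BM (svalP x) (svalP y)).

Lemma sval_inj : injective (@sval S B).
Proof. by case=> x Bx [y By] /= xy; subst y; congr exist; apply: Prop_irrelevance. Qed.

Fact sub_addA : associative add.
Proof. by move=> x y w; apply: sval_inj; apply: saddA. Qed.
Fact sub_addC : commutative add.
Proof. by move=> x y; apply: sval_inj; apply: saddC. Qed.
Fact sub_mulA : associative mul.
Proof. by move=> x y w; apply: sval_inj; apply: smulA. Qed.
Fact sub_mulDl : left_distributive mul add.
Proof. by move=> x y w; apply: sval_inj; apply: smulDl. Qed.
Fact sub_mulDr : right_distributive mul add.
Proof. by move=> x y w; apply: sval_inj; apply: smulDr. Qed.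

Definition sub_semiring : semiring :=
  Semiring sub_addA sub_addC sub_mulA sub_mulDl sub_mulDr.
End Subsemiring.

(** * Separating families of maps between flat semirings *)

Section FlatFamily.
Variables (S : eqType) (mul : S -> S -> S) (z : S).
Hypotheses (mulA : associative mul) (mul0 : left_zero z mul)
  (mulr0 : right_zero z mul) (mulI : zero_cancellative mul z).
Variables (S' : eqType) (mul' : S' -> S' -> S') (z' : S').
Hypotheses (mulA' : associative mul') (mul0' : left_zero z' mul')
  (mulr0' : right_zero z' mul') (mulI' : zero_cancellative mul' z').
Variables (I : Type) (i0 : I) (F : I -> S -> S').
Hypotheses (F_neq0 : forall i x, x <> z -> F i x <> z')
  (F_mul : forall i x y, mul x y <> z -> F i (mul x y) = mul' (F i x) (F i y))
  (F_mul0 : forall x y, x <> z -> y <> z -> mul x y = z ->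
    exists i, mul' (F i x) (F i y) = z')
  (F_sep : forall x y, x <> z -> y <> z -> x <> y -> exists i, F i x <> F i y).

Let S'_flat := flat_semiring mulA' mul0' mulr0' mulI'.
Let S_flat := flat_semiring mulA mul0 mulr0 mulI.
Let P := prod_semiring (fun _ : I => S'_flat).

Let represents (p : P) x := x <> z /\ forall i, p i = F i x.
Let vanishes (p : P) := exists i, p i = z'.
Let good p := (exists x, represents p x) \/ vanishes p.

Let flat_add_neq (T : eqType) (t x y : T) : x <> y -> flat_add t x y = t.
Proof. by rewrite /flat_add; case: eqP. Qed.

Let flat_addxx (T : eqType) (t x : T) : flat_add t x x = x.
Proof. by rewrite /flat_add eqxx. Qed.

Let flat_add0 (T : eqType) (t x : T) : flat_add t t x = t.
Proof. by rewrite /flat_add; case: eqP. Qed.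

Let vanishes_add q p : vanishes p -> vanishes (sadd p q).
Proof. by case=> i pi; exists i; rewrite /= pi flat_add0. Qed.

Let vanishes_mull p q : vanishes p -> vanishes (smul p q).
Proof. by case=> i pi; exists i; rewrite /= pi mul0'. Qed.

Let vanishes_mulr p q : vanishes q -> vanishes (smul p q).
Proof. by case=> i qi; exists i; rewrite /= qi mulr0'. Qed.

Let represents_add p q x y : represents p x -> represents q y -> x <> y ->
  vanishes (sadd p q).
Proof.
move=> [x0 px] [y0 qy] xy; have [i Fxy] := F_sep x0 y0 xy.
by exists i; rewrite /= px qy flat_add_neq.
Qed.

Let represents_addxx p q x : represents p x -> represents q x ->
  represents (sadd p q) x.
Proof. by move=> [x0 px] [_ qx]; split=> // i; rewrite /= px qx flat_addxx. Qed.

Let represents_mul p q x y : represents p x -> represents q y ->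
  mul x y <> z -> represents (smul p q) (mul x y).
Proof. by move=> [x0 px] [y0 qy] xy; split=> // i; rewrite /= px qy F_mul. Qed.

Let represents_mul0 p q x y : represents p x -> represents q y ->
  mul x y = z -> vanishes (smul p q).
Proof.
move=> [x0 px] [y0 qy] xy; have [i Fxy] := F_mul0 x0 y0 xy.
by exists i; rewrite /= px qy.
Qed.

Let good_add p q : good p -> good q -> good (sadd p q).
Proof.
move=> [[x px]|p0]; last by right; apply: vanishes_add.
move=> [[y qy]|q0]; last by right; rewrite saddC; apply: vanishes_add.
have [xy|/eqP xy] := eqVneq x y; last by right; apply: represents_add px qy xy.
by subst y; left; exists x; apply: represents_addxx.
Qed.

Let good_mul p q : good p -> good q -> good (smul p q).
Proof.
move=> [[x px]|p0]; last by right; apply: vanishes_mull.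
move=> [[y qy]|q0]; last by right; apply: vanishes_mulr.
have [xy|/eqP xy] := eqVneq (mul x y) z; first by right; apply: represents_mul0 px qy xy.
by left; exists (mul x y); apply: represents_mul.
Qed.

Let D := sub_semiring good_add good_mul.

(** [F_sep] makes the represented element unique and [F_neq0] keeps represented and vanishing tuples
    apart; the default [z] is the collapse of the vanishing ones. *)
Let val_rep (p : D) : S_flat :=
  if pselect (exists x, represents (sval p) x) is left ex then sval (cid ex) else z.

Let val_repE p x : represents (sval p) x -> val_rep p = x.
Proof.
move=> px; rewrite /val_rep; case: pselect => [ex|[]]; last by exists x.
case: cid => y /= py; apply/eqP/contraT => /eqP yx.
have [i] := F_sep py.1 px.1 yx.
by rewrite -(py.2 i) -(px.2 i).
Qed.

Let val_rep0 p : vanishes (sval p) -> val_rep p = z.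
Proof.
move=> [i pi]; rewrite /val_rep; case: pselect => // ex.
by case: cid => y [y0 py] /=; case: (F_neq0 (i := i) y0); rewrite -py.
Qed.

Lemma flat_family_variety : variety_gen S'_flat S_flat.
Proof.
move=> K vK KS'.
have KD : K D.
  apply: (variety_sub vK (S := P) (f := fun p : D => sval p)) => //.
    exact: sval_inj.
  exact: variety_prod.
apply: (variety_hom vK (f := val_rep)) KD; last first.
  move=> x; have [->|/eqP x0] := eqVneq x z.
    (* With [I] empty no tuple would vanish, and [z] would have no preimage. *)
    have v0 : vanishes (fun=> z') by exists i0.
    by exists (exist good _ (or_intror v0)); apply: val_rep0.
  have px : represents (F^~ x) x by [].
  by exists (exist good _ (or_introl (ex_intro _ x px))); apply: val_repE.
split=> p q /=.
- case: (svalP p) => [[x px]|p0]; last first.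
    by rewrite (val_rep0 p0) flat_add0; apply: val_rep0; apply: vanishes_add.
  case: (svalP q) => [[y qy]|q0]; last first.
    rewrite (val_rep0 q0) flat_addC flat_add0; apply: val_rep0.
    by have := vanishes_add (sval p) q0; rewrite saddC.
  rewrite (val_repE px) (val_repE qy).
  have [xy|/eqP xy] := eqVneq x y; last first.
    by rewrite flat_add_neq //; apply: val_rep0; apply: represents_add px qy xy.
  by subst y; rewrite flat_addxx; apply: val_repE; apply: represents_addxx.
- case: (svalP p) => [[x px]|p0]; last first.
    by rewrite (val_rep0 p0) mul0; apply: val_rep0; apply: vanishes_mull.
  case: (svalP q) => [[y qy]|q0]; last first.
    by rewrite (val_rep0 q0) mulr0; apply: val_rep0; apply: vanishes_mulr.
  rewrite (val_repE px) (val_repE qy).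
  have [xy|/eqP xy] := eqVneq (mul x y) z; last first.
    by apply: val_repE; apply: represents_mul.
  by rewrite xy; apply: val_rep0; apply: represents_mul0 px qy xy.
Qed.
End FlatFamily.

(** * Families of hypergraph homomorphisms *)

Section HypergraphFamily.
Variables (H H' : hypergraph3) (I : Type) (i0 : I) (phi : I -> H -> H').
Hypotheses
  (phi_edge : forall i e, e \in hyperedges H -> phi i @: e \in hyperedges H')
  (phi_sep : forall u v, u <> v -> exists i, phi i u <> phi i v)
  (phi_nonadj : forall u v, (forall w, [set u; v; w] \notin hyperedges H) ->
    exists i, forall w, [set phi i u; phi i v; w] \notin hyperedges H').

(** As edges map to edges, the vertex completing a pair maps to the one completing its image; this
    forces the value on [MP w]. *)
Let model_map i (x : hg_model H) : hg_model H' :=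
  match x with
  | M0 => M0 _ | MV u => MV (phi i u) | MP w => MP (phi i w) | MT => MT _
  end.

Let phi_edge3 i u v w : [set u; v; w] \in hyperedges H ->
  [set phi i u; phi i v; phi i w] \in hyperedges H'.
Proof. by move/(phi_edge i); rewrite !imsetU !imset_set1. Qed.

Let model_map_mul i x y : model_mul x y <> M0 _ ->
  model_map i (model_mul x y) = model_mul (model_map i x) (model_map i y).
Proof.
case: x => [|u|u|] //; case: y => [|v|v|] //.
- by case: model_VVP => // w /(phi_edge3 i)/model_VV->.
- by rewrite /=; case: eqP => // ->; rewrite eqxx.
- by rewrite /=; case: eqP => // ->; rewrite eqxx.
Qed.

(** There are three ways to vanish: a nonadjacent pair, handled by [phi_nonadj]; a pair times a
    vertex that does not complete it, handled by [phi_sep]; degree above three, where any index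
    does. *)
Let model_map_mul0 x y : x <> M0 _ -> y <> M0 _ -> model_mul x y = M0 _ ->
  exists i, model_mul (model_map i x) (model_map i y) = M0 _.
Proof.
have VP u v : model_mul (MV u) (MP v) = M0 _ ->
    exists i, model_mul (MV (phi i u)) (MP (phi i v)) = M0 _.
  rewrite /=; case: eqP => // uv _; have [i phi_uv] := phi_sep uv.
  by exists i; case: eqP.
case: x => [|u|u|] //; case: y => [|v|v|] //; try by exists i0.
- case: model_VVP => // /phi_nonadj[i ni] _ _ _; exists i.
  rewrite [model_map i _]/= [model_map i _]/=.
  by case: model_VVP => // w; rewrite (negPf (ni w)).
- by move=> _ _ /VP.
- by move=> _ _; rewrite model_mulC => /VP[i i0']; exists i; rewrite model_mulC.
Qed.

Let model_map_sep x y : x <> y -> exists i, model_map i x <> model_map i y.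
Proof.
case: x => [|u|u|]; case: y => [|v|v|]; try by exists i0.
all: move=> uv; have /phi_sep[i ni] : u <> v by congruence.
all: by exists i; case.
Qed.

Let word_map_subproof i (s : word (hg_generator H)) :
  map (omap (phi i)) (val s) != [::].
Proof. by case: s => -[]. Qed.
Let word_map i (s : word (hg_generator H)) : word (hg_generator H') :=
  Sub (map (omap (phi i)) (val s)) (word_map_subproof i s).

Local Open Scope quotient_scope.

(** A word equal to zero can have a nonzero image, so this map is controlled only off [hg_zero],
    which is all that [flat_family_variety] asks. *)
Let hg_map i (x : hg_semigroup H) : hg_semigroup H' :=
  \pi_(hg_semigroup H') (word_map i (repr x)).

Let model_eval_map i s : model_eval s <> M0 H ->
  model_eval (map (omap (phi i)) s) = model_map i (model_eval s).
Proof.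
elim: s => [//|g [|g' s] IH]; first by case: g.
have: g' :: s != [::] by [].
move: (g' :: s) IH => t IH t0; have mt0 : map (omap (phi i)) t != [::] by case: t t0 {IH}.
rewrite map_cons !model_evalE // => gt0.
rewrite IH; last by move=> et0; apply: gt0; rewrite et0; case: (model_gen g).
by rewrite model_map_mul //; case: g {gt0}.
Qed.

Let hg_eval_neq0 K (x : hg_semigroup K) : x <> hg_zero K <-> hg_eval x <> M0 K.
Proof.
split=> x0 ex; last by apply: x0; rewrite ex hg_eval0.
by apply: x0; apply: hg_eval_inj; rewrite hg_eval0.
Qed.

Let hg_eval_map i x : x <> hg_zero H ->
  hg_eval (hg_map i x) = model_map i (hg_eval x).
Proof. by move=> /hg_eval_neq0 x0; rewrite hg_eval_pi; apply: model_eval_map. Qed.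

Let hg_mul_neq0 (x y : hg_semigroup H) :
  hg_mul x y <> hg_zero H -> x <> hg_zero H /\ y <> hg_zero H.
Proof.
move=> xy; split=> e; apply: xy; rewrite e.
  exact: hg_mul0l.
exact: hg_mul0r.
Qed.

Lemma hom_family_variety : variety_gen (hg_semiring H') (hg_semiring H).
Proof.
apply: (@flat_family_variety _ _ _ (@hg_mulA H) (@hg_mul0l H) (@hg_mul0r H)
  (@hg_zero_cancellative H) _ _ _ (@hg_mulA H') (@hg_mul0l H') (@hg_mul0r H')
  (@hg_zero_cancellative H') _ i0 hg_map).
- move=> i x x0; apply/hg_eval_neq0; rewrite hg_eval_map //.
  by move/hg_eval_neq0: x0; case: (hg_eval x).
- move=> i x y xy; have [x0 y0] := hg_mul_neq0 xy.
  apply: hg_eval_inj; rewrite hg_evalM !hg_eval_map // hg_evalM model_map_mul //.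
  by rewrite -hg_evalM; apply/hg_eval_neq0.
- move=> x y x0 y0 /(congr1 (@hg_eval H)); rewrite hg_evalM hg_eval0.
  case/model_map_mul0 => [||i xy]; [exact/hg_eval_neq0..|exists i].
  by apply: hg_eval_inj; rewrite hg_evalM hg_eval0 !hg_eval_map.
- move=> x y x0 y0 xy.
  have /model_map_sep[i nxy] : hg_eval x <> hg_eval y by move/hg_eval_inj.
  exists i => /(congr1 (@hg_eval H')); by rewrite !hg_eval_map.
Qed.
End HypergraphFamily.

(** * Adjacency of vertices *)

Section Adjacency.
Variable H : hypergraph3.

Definition adjacent (u v : H) : Prop := exists w, [set u; v; w] \in hyperedges H.

Lemma nonadjacentP u v :
  (forall w, [set u; v; w] \notin hyperedges H) <-> ~ adjacent u v.
Proof.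
split=> [n [w]|n w]; first exact/negP.
by apply/negP => e; apply: n; exists w.
Qed.

Lemma adjacentP u v : adjacent u v <->
  u <> v /\ exists e, [/\ e \in hyperedges H, u \in e & v \in e].
Proof.
split=> [[w e]|[/eqP uv [e [eE ue ve]]]].
  have [/eqP uv _ _] := edge_neq e.
  by split=> //; exists [set u; v; w]; rewrite !inE !eqxx orbT.
have sub : [set u; v] \subset e by apply/subsetP => x; rewrite !inE => /orP[]/eqP->.
have : #|e :\: [set u; v]| = 1.
  by rewrite cardsD (setIidPr sub) (hyperedge_card eE) cards2 uv.
move=> /eqP/cards1P[w ew]; exists w.
by rewrite -ew -{1}(setIidPr sub) setID.
Qed.

Lemma adjacentC u v : adjacent u v -> adjacent v u.
Proof. by case=> w; rewrite set3_swap; exists w. Qed.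
End Adjacency.

(** * Coordinates on beams *)

(* The indices of the two corners completing the edge of a midpoint; both are
   the index itself on a corner. *)
Definition lo i (v : beam i) : nat :=
  match v with inl (inl k) => k | inl (inr j) => j | inr j => j end.
Definition hi i (v : beam i) : nat :=
  match v with inl (inl k) => k | inl (inr j) => j.+1 | inr j => j.+2 end.

(** The difference of [hi] and [lo] is 0, 1 or 2 according to the kind of vertex, and [lo] is the
    index within that kind. *)
Lemma lo_hi_inj i (u v : beam i) : lo u = lo v -> hi u = hi v -> u = v.
Proof.
case: u => [[k|j]|j]; case: v => [[k'|j']|j'] /= l h; try lia.
all: by do ?congr inl; do ?congr inr; apply: val_inj.
Qed.

Lemma lo_hi_bounds i (v : beam i) : lo v <= hi v < i.+2.
Proof. by case: v => [[[k ?]|[j ?]]|[j ?]] /=; lia. Qed.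

Lemma lo_corner i k : k < i.+2 -> lo (corner i k : beam i) = k.
Proof. by move=> ki; rewrite /= inordK. Qed.
Lemma hi_corner i k : k < i.+2 -> hi (corner i k : beam i) = k.
Proof. by move=> ki; rewrite /= inordK. Qed.

Lemma cornerE i (v : beam i) : lo v = hi v -> v = corner i (lo v).
Proof.
move=> lv; have := lo_hi_bounds v => b.
by apply: lo_hi_inj; rewrite ?lo_corner ?hi_corner //; lia.
Qed.

(** Each edge holds exactly one midpoint, whose coordinates give its corners, so midpoints index the
    edges. *)
Lemma beam_edge_memP i e : e \in hyperedges (beam i) <->
  exists m : beam i, lo m < hi m /\ e = [set corner i (lo m); m; corner i (hi m)].
Proof.
split=> [/setUP[]/imsetP[j _ ->]|[[[k|j]|j] [//= mm ->]]].
- by exists (midpoint j).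
- by exists (midpoint' j) => /=.
- by rewrite ltnn in mm.
- by apply/setUP; left; apply/imsetP; exists j.
- by apply/setUP; right; apply/imsetP; exists j.
Qed.

(* Adjacency of the vertices with [lo] and [hi] equal to [a, b] and [c, d]. *)
Definition beam_adj (a b c d : nat) : bool :=
  [|| [&& a == b, c == d & (a < c < a + 3) || (c < a < c + 3)],
      [&& a == b, c < d & (a == c) || (a == d)]
    | [&& a < b, c == d & (c == a) || (c == b)]].

Lemma exists_midpoint i p q : p < q < i.+2 -> q < p + 3 ->
  exists m : beam i, lo m = p /\ hi m = q.
Proof.
move=> pq gap; have [->|qp] := eqVneq q p.+1.
  by have pi : p < i.+1 by [lia]; exists (inl (inr (Ordinal pi))).
have pi : p < i by lia.
by exists (inr (Ordinal pi)); split=> //=; lia.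
Qed.

Lemma beam_adjacentP i (u v : beam i) :
  adjacent u v <-> beam_adj (lo u) (hi u) (lo v) (hi v).
Proof.
split=> [/adjacentP[uv [e [/beam_edge_memP[m [mm ->]]]]]|].
- have := lo_hi_bounds m; rewrite !inE => b ue ve.
  have gap : hi m < lo m + 3 by clear; case: m => [[k|j]|j] /=; lia.
  have cl : lo m < i.+2 by lia.
  have ch : hi m < i.+2 by lia.
  move: uv; rewrite /beam_adj.
  case/orP: ue => [/orP[]|] /eqP->; case/orP: ve => [/orP[]|] /eqP-> //;
    by rewrite ?(lo_corner cl, lo_corner ch, hi_corner cl, hi_corner ch); lia.
(* Two midpoints are never adjacent, so up to symmetry [u] is a corner and [v] is a midpoint or a
   corner further along. *)
- wlog uv : u v / (lo u == hi u) && ((lo v < hi v) || (lo u < lo v)).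
  have bu := lo_hi_bounds u; have bv := lo_hi_bounds v.
  move=> wl adj; have [|nuv] := boolP ((lo u == hi u) && ((lo v < hi v) || (lo u < lo v))).
    by move/wl; apply.
  by apply: adjacentC; apply: wl; move: nuv adj; rewrite /beam_adj; lia.
have mid m : lo m < hi m -> u <> v ->
    u \in [set corner i (lo m); m; corner i (hi m)] ->
    v \in [set corner i (lo m); m; corner i (hi m)] -> adjacent u v.
  move=> mm nuv ue ve; apply/adjacentP; split=> //.
  by exists [set corner i (lo m); m; corner i (hi m)]; split=> //; apply/beam_edge_memP; exists m.
case/andP: uv => /eqP lu uv; have bu := lo_hi_bounds u; have bv := lo_hi_bounds v.
have nuv : u <> v by move=> e; move: uv; rewrite -e lu; lia.
have [lv|lv] := ltnP (lo v) (hi v) => adj.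
  apply: (mid v) => //; rewrite !inE ?eqxx ?orbT // (cornerE lu).
  have [->|->] : lo u = lo v \/ lo u = hi v by move: adj; rewrite /beam_adj; lia.
    by rewrite eqxx.
  by rewrite eqxx orbT.
have {}lv : lo v = hi v by lia.
have [||m [lm hm]] := @exists_midpoint i (lo u) (lo v); [lia|move: adj; rewrite /beam_adj; lia|].
apply: (mid m); rewrite ?lm ?hm //; first by lia.
  by rewrite !inE -(cornerE lu) eqxx.
by rewrite !inE -(cornerE lv) eqxx orbT.
Qed.

(** * The inclusion of a shorter beam *)

Section Inclusion.
Variables (j i : nat) (ji : j <= i).

Definition beam_incl (v : beam j) : beam i :=
  match v with
  | inl (inl k) => inl (inl (widen_ord (ji : j.+2 <= i.+2) k))
  | inl (inr k) => inl (inr (widen_ord (ji : j.+1 <= i.+1) k))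
  | inr k => inr (widen_ord ji k)
  end.

Lemma lo_incl v : lo (beam_incl v) = lo v.
Proof. by case: v => [[]|]. Qed.
Lemma hi_incl v : hi (beam_incl v) = hi v.
Proof. by case: v => [[]|]. Qed.

Lemma incl_corner k : k < j.+2 -> beam_incl (corner j k : beam j) = corner i k.
Proof.
move=> kj; have ki : k < i.+2 by lia.
by apply: lo_hi_inj; rewrite ?lo_incl ?hi_incl ?lo_corner ?hi_corner.
Qed.

(** One map suffices: the inclusion keeps [lo] and [hi], which decide adjacency. *)
Lemma beam_incl_variety :
  variety_gen (hg_semiring (beam i)) (hg_semiring (beam j)).
Proof.
apply: (hom_family_variety tt (phi := fun=> beam_incl)).
- move=> _ e /beam_edge_memP[m [mm ->]]; apply/beam_edge_memP; exists (beam_incl m).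
  have b := lo_hi_bounds m.
  rewrite lo_incl hi_incl mm !imsetU !imset_set1 !incl_corner //; lia.
- move=> u v uv; exists tt => e; apply: uv.
  by apply: lo_hi_inj; rewrite -?lo_incl -?hi_incl e.
- move=> u v /nonadjacentP nuv; exists tt; apply/nonadjacentP.
  by move/beam_adjacentP; rewrite !lo_incl !hi_incl => /beam_adjacentP.
Qed.
End Inclusion.

(** * Colours and midpoints in the triangle *)

Definition is_mid i (v : beam i) : bool := lo v < hi v.

Lemma mid_nonadjacent i (u v : beam i) : is_mid u -> is_mid v -> ~ adjacent u v.
Proof. by rewrite /is_mid => mu mv /beam_adjacentP; rewrite /beam_adj; lia. Qed.

(* The corner of colour [r], or the midpoint opposite to it. *)
Definition triangle_vertex (r : nat) (b : bool) : beam 1 :=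
  match r with
  | 0 => if b then inl (inr ord_max) else corner 1 0
  | 1 => if b then inr ord0 else corner 1 1
  | _ => if b then inl (inr ord0) else corner 1 2
  end.

Lemma is_mid_triangle_vertex r b : is_mid (triangle_vertex r b) = b.
Proof. by case: r => [|[|r]]; case: b; rewrite /is_mid //= ltnn. Qed.

(** The only midpoint selects one of the three edges; the cases then differ by the order of the
    vertices. *)
Lemma triangle_vertex_edge (r s t : nat) (x y z : bool) :
  r < 3 -> s < 3 -> t < 3 -> r != s -> s != t -> r != t -> x + y + z = 1 ->
  [set triangle_vertex r x; triangle_vertex s y; triangle_vertex t z]
    \in hyperedges (beam 1).
Proof.
have e0 : [set corner 1 1; inl (inr ord_max); corner 1 2] \in hyperedges (beam 1).
  by apply/beam_edge_memP; exists (inl (inr ord_max)).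
have e1 : [set corner 1 0; inr ord0; corner 1 2] \in hyperedges (beam 1).
  by apply/beam_edge_memP; exists (inr ord0).
have e2 : [set corner 1 0; inl (inr ord0); corner 1 1] \in hyperedges (beam 1).
  by apply/beam_edge_memP; exists (inl (inr ord0)).
have rot := @set3_rot (beam 1); have swap := @set3_swap (beam 1).
case: r => [|[|[|r]]] //; case: s => [|[|[|s]]] //; case: t => [|[|[|t]]] //.
all: move=> _ _ _ _ _ _; case: x; case: y; case: z => //= _.
all: first [assumption | rewrite rot; assumption | rewrite -rot; assumption
  | rewrite swap; assumption | rewrite swap rot; assumption
  | rewrite swap -rot; assumption].
Qed.

(** * Folding a beam along transversals *)

Section Transversal.
Variable i : nat.

(* Two corners of a beam share an edge exactly when their indices differ by 1
   or 2. *)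
Definition sparse (X : pred nat) : Prop :=
  forall p q, X p -> X q -> p < q -> p + 3 <= q.

(* The corners with index in [X], completed by the midpoints of the edges that
   contain none of them. *)
Definition transversal (X : pred nat) (v : beam i) : bool :=
  if lo v == hi v then X (lo v) else ~~ (X (lo v) || X (hi v)).

(* [2 * (lo v + hi v)] is [lo v] modulo 3 on a corner, and the third residue on
   a midpoint. *)
Definition beam_fold (X : pred nat) (v : beam i) : beam 1 :=
  triangle_vertex ((2 * (lo v + hi v)) %% 3) (transversal X v).

(** The corners of an edge differ in index by 1 or 2, so its three colours are distinct; sparseness
    leaves at most one of these corners in [X], so exactly one vertex of the edge lies in the
    transversal. *)
Lemma beam_fold_edge X e : sparse X -> e \in hyperedges (beam i) ->
  beam_fold X @: e \in hyperedges (beam 1).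
Proof.
move=> sX /beam_edge_memP[m [mm ->]]; have b := lo_hi_bounds m.
have gap : hi m < lo m + 3 by clear; case: m => [[[k ?]|[k ?]]|[k ?]] /=; lia.
rewrite !imsetU !imset_set1 /beam_fold; apply: triangle_vertex_edge.
all: rewrite /transversal ?lo_corner ?hi_corner ?eqxx; try lia.
rewrite (ltn_eqF mm); have := sX (lo m) (hi m).
by case: (X (lo m)); case: (X (hi m)) => //= /(_ isT isT mm); lia.
Qed.

(** The empty set yields all midpoints and so separates corners from midpoints. A singleton
    separates two corners, and also two midpoints if its corner lies on the edge of just one of
    them. *)
Lemma transversal_sep u v : u <> v ->
  exists2 X, sparse X & transversal X u <> transversal X v.
Proof.
move=> uv; rewrite /transversal.
have single k : sparse (pred1 k) by move=> p q /eqP-> /eqP->; lia.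
have bu := lo_hi_bounds u; have bv := lo_hi_bounds v.
have {}uv : lo u <> lo v \/ hi u <> hi v.
  by have [l|l] := eqVneq (lo u) (lo v); [right => /(lo_hi_inj l)|left; apply/eqP].
have [lu|lu] := eqVneq (lo u) (hi u); have [lv|lv] := eqVneq (lo v) (hi v).
- by exists (pred1 (lo u)) => //=; lia.
- by exists pred0.
- by exists pred0.
- have [lluv|nll] := eqVneq (lo u) (lo v); last have [hluv|nhl] := eqVneq (lo u) (hi v).
  + by exists (pred1 (hi u)) => //=; lia.
  + by exists (pred1 (hi u)) => //=; lia.
  + by exists (pred1 (lo u)) => //=; lia.
Qed.

(** Take for [X] the corners among [u] and [v]: nonadjacency makes it sparse and keeps it off the
    edge of any midpoint among them. *)
Lemma transversal_nonadjacent u v : ~ adjacent u v ->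
  exists2 X, sparse X & transversal X u /\ transversal X v.
Proof.
move=> nuv; pose X := [pred k | (lo u == hi u) && (k == lo u) || (lo v == hi v) && (k == lo v)].
have bu := lo_hi_bounds u; have bv := lo_hi_bounds v.
have {}nuv : ~~ beam_adj (lo u) (hi u) (lo v) (hi v) by apply/negP => /beam_adjacentP.
exists X; first by move=> p q /=; move: nuv; rewrite /beam_adj; lia.
by move: nuv; rewrite /beam_adj /transversal /=; do 2!case: ifP => ?; split; lia.
Qed.

Lemma beam_fold_variety :
  variety_gen (hg_semiring (beam 1)) (hg_semiring (beam i)).
Proof.
(* The index type is that of all sparse sets; the empty set inhabits it. *)
have s0 : sparse pred0 by [].
apply: (hom_family_variety (exist sparse _ s0) (phi := fun X => beam_fold (sval X))).
- by case=> X sX e; apply: beam_fold_edge.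
- move=> u v /transversal_sep[X sX Xuv]; exists (exist _ X sX) => /(congr1 (@is_mid 1)).
  by rewrite !is_mid_triangle_vertex.
- move=> u v /nonadjacentP/transversal_nonadjacent[X sX [Xu Xv]].
  exists (exist _ X sX); apply/nonadjacentP/mid_nonadjacent.
    by rewrite is_mid_triangle_vertex.
  by rewrite is_mid_triangle_vertex.
Qed.
End Transversal.

Theorem proposition4p3 (i : nat) (i_ge1 : 1 <= i) :
  forall T : semiring,
    variety_gen (hg_semiring (beam i)) T <-> variety_gen (hg_semiring (beam 1)) T.
Proof.
move=> T; split; apply: variety_gen_trans; first exact: beam_fold_variety.
(* The hypothesis [1 <= i] places the triangle inside the beam. *)
exact: beam_incl_variety.
Qed.
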